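(* Let $(X,T)$ be a flow, where $X$ is a compact metric space, and let $(2^X,T)$ be the induced flow. Then there is a continuous flow homomorphism $\Theta: E(2^X)\longrightarrow E(X)$.
   Context: A flow $(X,T)$ is a continuous action of a discrete group $T$ on a compact space $X$; $\pi^t:X\to X$ denotes the map $x\mapsto tx$. $2^X$ is the space of all nonempty closed subsets of $X$ with the Vietoris topology (equivalently, the Hausdorff metric topology). The flow $(X,T)$ induces the flow $(2^X,T)$ via $\pi^t_*(A)=\pi^t(A)=\{ta: a\in A\}$. For a flow $(Y,T)$, the enveloping semigroup $E(Y)$ is the closure of $\{\pi^t: t\in T\}$ in $Y^Y$ with the product topology (topology of pointwise convergence); it is a compact Hausdorff semigroup under composition. $T$ acts on $E(Y)$ by $(t,p)\mapsto \pi^t\circ p$. A flow homomorphism $\phi:(Y,T)\to(Z,T)$ is a continuous surjection with $\phi(ty)=t\phi(y)$ for all $y\in Y$, $t\in T$. *)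

(* Defs.v *)
From HB Require Import structures.
From mathcomp Require Import all_boot all_algebra.
From mathcomp Require Import all_classical all_reals all_analysis.

Set Implicit Arguments.
Unset Strict Implicit.
Unset Printing Implicit Defensive.

Local Open Scope classical_set_scope.

(* The acting group carries the discrete topology; [groupType] itself comes with
   no topology and no finiteness assumption. *)
Record flow (T : groupType) (X : topologicalType) := Flow {
  act :> T -> X -> X ;
  flow_compact : compact [set: X] ;
  act1 : forall x, act 1%g x = x ;
  actM : forall s t x, act (s * t)%g x = act s (act t x) ;
  act_continuous : continuous (fun p : discrete_topology T * X => act p.1 p.2)
}.

Record flow_hom (T : groupType) (Y Z : topologicalType)
    (F : flow T Y) (G : flow T Z) (f : Y -> Z) : Prop := FlowHom {
  flow_hom_continuous : continuous f ;
  flow_hom_surj : forall z, exists y, f y = z ;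
  flow_hom_equivariant : forall t y, f (F t y) = G t (f y)
}.

Section flow_lemmas.
Context {T : groupType} {X : topologicalType}.

Lemma discrete_act_continuous (a : T -> X -> X) :
  (forall t, continuous (a t)) ->
  continuous (fun p : discrete_topology T * X => a p.1 p.2).
Proof.
move=> ac [t x] U /ac Ux; exists ([set t], a t @^-1` U).
  by split => //=; exact: discrete_set1.
by move=> [s y] /= [-> ].
Qed.

Variable F : flow T X.

Lemma act_continuous1 t : continuous (F t).
Proof.
move=> x U /(@act_continuous _ _ F (t, x)) [[P Q] /= [Pt Qx] PQU].
apply: filterS Qx => y Qy; apply: (PQU (t, y)); split => //.
exact: (@nbhs_singleton (discrete_topology T)).
Qed.

Lemma actK t : cancel (F t) (F t^-1%g).
Proof. by move=> x; rewrite -actM mulVg act1. Qed.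

Lemma actVK t : cancel (F t^-1%g) (F t).
Proof. by move=> x; rewrite -actM mulgV act1. Qed.

Lemma act_imageE t (A : set X) : F t @` A = F t^-1%g @^-1` A.
Proof.
apply/seteqP; split => [_ [x Ax <-]|x Ax] /=; first by rewrite actK.
by exists (F t^-1%g x) => //; rewrite actVK.
Qed.

End flow_lemmas.

Record hyperspace (X : topologicalType) := Hyperspace {
  hset :> set X ;
  hset_closed : closed hset ;
  hset_neq0 : hset !=set0
}.

Lemma hyperspace_inj {X : topologicalType} : injective (@hset X).
Proof.
move=> [A cA A0] [B cB B0] /= AB; case: _ / AB cB B0 => cB B0.
by rewrite (Prop_irrelevance cA cB) (Prop_irrelevance A0 B0).
Qed.

HB.instance Definition _ (X : topologicalType) := gen_eqMixin (hyperspace X).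
HB.instance Definition _ (X : topologicalType) :=
  gen_choiceMixin (hyperspace X).

(* The subbase of the Vietoris topology consists of the families
   {A | A `<=` U} and {A | A meets U}, for U open in X. *)
Definition vietoris_subset {X : topologicalType} (U : set X) :
  set (hyperspace X) := [set A | A `<=` U].

Definition vietoris_meet {X : topologicalType} (U : set X) :
  set (hyperspace X) := [set A | A `&` U !=set0].

Definition vietoris_subbase {X : topologicalType} : set (set (hyperspace X)) :=
  [set vietoris_subset U | U in open] `|` [set vietoris_meet U | U in open].

HB.instance Definition _ (X : topologicalType) :=
  isSubBaseTopological.Build (hyperspace X) (@vietoris_subbase X) id.

Section vietoris.
Context {X : topologicalType}.

Lemma vietoris_subbase_open (W : set (hyperspace X)) :
  vietoris_subbase W -> open W.
Proof.
move=> W_; exists [set W]; last by rewrite bigcup_set1.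
by move=> _ ->; exact: (finI_from1 id).
Qed.

Lemma vietoris_cvg (F : set_system (hyperspace X)) {FF : Filter F}
    (A : hyperspace X) :
  (forall W, vietoris_subbase W -> W A -> F W) -> F --> A.
Proof.
move=> FW U; rewrite nbhsE => -[V [[B BD <-] [I BI IA]] VU].
apply: (filterS (fun x Ix => VU x (ex_intro2 _ _ I BI Ix))).
have [D DD DI] := BD _ BI; rewrite -DI.
apply: filter_bigI => i iD; apply: FW; first by have := DD _ iD; rewrite inE.
by move: IA; rewrite -DI; exact.
Qed.

Lemma cluster_vietoris (F : set_system (hyperspace X))
    (s : hyperspace X -> X) (x : X) (U : set X) :
  UltraFilter F -> F [set B | hset B (s B)] ->
  cluster (s @ F) x -> open U -> U x -> F (vietoris_meet U).
Proof.
move=> FU Fs clx oU Ux.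
have [//|FC] := in_ultra_setVsetC (vietoris_meet U) FU.
have : (~` U) `&` U !=set0; last by case=> y [].
apply: (clx (~` U) U); last by apply: open_nbhs_nbhs; split.
suff: F (s @^-1` ~` U) by [].
by apply: filterS (filterI Fs FC) => B [Bs nBU] /= UsB; apply: nBU; exists (s B).
Qed.

Lemma hyperspace_compact :
  compact [set: X] -> compact [set: hyperspace X].
Proof.
move=> cX; rewrite compact_ultra => F FU _.
pose L := [set x | forall U, open U -> U x -> F (vietoris_meet U)].
pose c (B : hyperspace X) : X := projT1 (cid (hset_neq0 B)).
have cB B : hset B (c B) by exact: projT2 (cid _).
have clL (s : hyperspace X -> X) x : F [set B | hset B (s B)] ->
    cluster (s @ F) x -> L x.
  by move=> Fs clx U; exact: (cluster_vietoris FU Fs clx).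
have clL0 (s : hyperspace X -> X) : cluster (s @ F) !=set0.
  have [x [_ ?]] := cX (s @ F) _ filterT.
  by exists x.
have Lcl : closed L.
  move=> x clx U oU Ux.
  by have [y [Ly Uy]] := clx _ (open_nbhs_nbhs (conj oU Ux)); exact: Ly.
have L0 : L !=set0.
  have [x clx] := clL0 c; exists x; apply: clL clx.
  by apply: filterS filterT => B _; exact: cB.
exists (Hyperspace Lcl L0); split => //; apply: vietoris_cvg => W.
move=> [] [U oU <-] /=; last by move=> [x [Lx Ux]]; exact: Lx.
move=> LU; have [//|FC] := in_ultra_setVsetC (vietoris_subset U) FU.
pose s (B : hyperspace X) := xget (c B) (B `\` U).
have sB (B : hyperspace X) : ~ (B `<=` U) -> (B `\` U) (s B).
  by move=> /nonsubset [y yBU]; rewrite /s; exact: (xgetPex _ (ex_intro _ y yBU)).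
have [x clx] := clL0 s.
have Ux : U x.
  by apply: LU; apply: clL clx; apply: filterS FC => B /sB [].
have : (~` U) `&` U !=set0; last by case=> y [].
apply: (clx (~` U) U); last by apply: open_nbhs_nbhs; split.
suff: F (s @^-1` ~` U) by [].
by apply: filterS FC => B /sB [].
Qed.

End vietoris.

Section induced_flow.
Context {T : groupType} {X : topologicalType} (F : flow T X).

Fact hact_closed t (A : hyperspace X) : closed (F t @` A).
Proof.
rewrite act_imageE; move/continuous_closedP: (@act_continuous1 _ _ F t^-1%g).
by apply; exact: hset_closed.
Qed.

Fact hact_neq0 t (A : hyperspace X) : F t @` A !=set0.
Proof. exact: image_nonempty (hset_neq0 A). Qed.

Definition hact t (A : hyperspace X) : hyperspace X :=
  Hyperspace (@hact_closed t A) (@hact_neq0 t A).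

Fact hact1 A : hact 1%g A = A.
Proof.
apply: hyperspace_inj => /=; rewrite -[RHS]image_id.
by apply: eq_imagel => x _; exact: act1.
Qed.

Fact hactM s t A : hact (s * t)%g A = hact s (hact t A).
Proof.
apply: hyperspace_inj => /=.
by rewrite image_comp; apply: eq_imagel => x _; exact: actM.
Qed.

Fact hact_continuous :
  continuous (fun p : discrete_topology T * hyperspace X => hact p.1 p.2).
Proof.
apply: discrete_act_continuous => t A.
apply: (@vietoris_cvg _ _ (fmap_filter _ (nbhs_filter A))) => W WX WA.
have oFU U : open U -> open (F t @^-1` U).
  by move/continuousP: (@act_continuous1 _ _ F t); exact.
apply: open_nbhs_nbhs; split => //; apply: vietoris_subbase_open.
case: WX => -[U oU <-]; [left|right]; exists (F t @^-1` U); try exact: oFU.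
- apply/seteqP; split => B /=; first by move=> BU _ [x Bx <-]; exact: BU.
  by move=> BU x Bx; apply: BU; exists x.
- apply/seteqP; split => B /=.
  + by move=> [x [Bx Ux]]; exists (F t x); split => //; exists x.
  + by move=> [_ [[x Bx <-] Ux]]; exists x.
Qed.

Definition induced_flow : flow T (hyperspace X) :=
  Flow (hyperspace_compact (flow_compact F)) hact1 hactM hact_continuous.

End induced_flow.

Lemma compact_set_type {X : topologicalType} (A : set X) :
  compact A -> compact [set: A].
Proof.
move=> cA F FF _.
have [|x [Ax clx]] := cA _ (fmap_proper_filter (set_val : A -> X) FF).
  suff: F (set_val @^-1` A) by [].
  by apply: filterS filterT => y _; exact: set_valP.
exists (exist _ x (mem_set Ax)); split => // P V FP.
rewrite nbhsE => -[_ [[W oW <-] Wx] WV].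
have [y [[z Pz zy] Wy]] : (set_val @` P) `&` W !=set0.
  apply: (clx (set_val @` P) W).
    suff: F (set_val @^-1` (set_val @` P)) by [].
    by apply: filterS FP => z Pz /=; exists z.
  exact: open_nbhs_nbhs.
by exists z; split => //; apply: WV; rewrite /= zy.
Qed.

Lemma ptws_cvg {X Y : topologicalType} (F : set_system {ptws X -> Y})
    {FF : Filter F} (f : {ptws X -> Y}) :
  (forall x, (fun g => g x) @ F --> f x) -> {ptws, F --> f}.
Proof.
move=> Ff; apply/cvg_sup => x U; rewrite nbhsE => -[_ [[B oB <-] Bx] BU].
by apply: filterS BU _; apply: (Ff x); exact: open_nbhs_nbhs.
Qed.

Lemma ptws_eval_continuous {X Y : topologicalType} (x : X) :
  continuous (fun p : {ptws X -> Y} => p x).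
Proof. exact: (@proj_continuous X (fun=> Y) x). Qed.

Lemma ptws_comp_continuous {X Y Z : topologicalType} (f : Y -> Z) :
  continuous f ->
  continuous (fun p : {ptws X -> Y} => f \o p : {ptws X -> Z}).
Proof.
move=> cf p; apply: (@ptws_cvg _ _ _ (fmap_filter _ (nbhs_filter p))) => x.
apply: (@continuous_comp _ _ _ (fun p : {ptws X -> Y} => p x) f).
  exact: ptws_eval_continuous.
exact: cf.
Qed.

Section enveloping.
Context {T : groupType} {Y : topologicalType} (F : flow T Y).

(* [{ptws Y -> Y}] carries the product topology.  Used as a type, [enveloping]
   carries the induced subspace topology. *)
Definition enveloping : set {ptws Y -> Y} :=
  closure [set (F t : {ptws Y -> Y}) | t in [set: T]].

Fact enveloping_closed t (p : {ptws Y -> Y}) :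
  enveloping p -> enveloping (F t \o p).
Proof.
move=> Ep U /(ptws_comp_continuous (@act_continuous1 _ _ F t)) /Ep.
move=> [_ [[s _ <-] Us]]; exists (F (t * s)%g); split; first by exists (t * s)%g.
by rewrite (_ : F (t * s)%g = F t \o F s)//; apply/funext => y; exact: actM.
Qed.

Definition enveloping_act t (p : enveloping) : enveloping :=
  exist _ (F t \o set_val p)
    (mem_set (enveloping_closed (t := t) (set_valP p))).

Fact enveloping_act1 p : enveloping_act 1%g p = p.
Proof. by apply: val_inj; apply/funext => y /=; rewrite act1. Qed.

Fact enveloping_actM s t p :
  enveloping_act (s * t)%g p = enveloping_act s (enveloping_act t p).
Proof. by apply: val_inj; apply/funext => y /=; rewrite actM. Qed.

Fact enveloping_act_continuous :
  continuous (fun p : discrete_topology T * enveloping =>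
    enveloping_act p.1 p.2).
Proof.
apply: discrete_act_continuous => t; apply: continuous_comp_initial => p.
apply: (@continuous_comp _ _ _ (set_val : enveloping -> {ptws Y -> Y})
  (fun q : {ptws Y -> Y} => F t \o q : {ptws Y -> Y})).
  exact: initial_continuous.
exact: ptws_comp_continuous (@act_continuous1 _ _ F t) _.
Qed.

Fact enveloping_compact : compact [set: enveloping].
Proof.
apply: compact_set_type; apply: (@subclosed_compact _ _ setT) => //.
  exact: closed_closure.
have := @tychonoff Y (fun=> Y) (fun=> setT) (fun=> flow_compact F).
by congr compact; apply/seteqP; split.
Qed.

Definition enveloping_flow : flow T enveloping :=
  Flow enveloping_compact enveloping_act1 enveloping_actM
    enveloping_act_continuous.

End enveloping.

(* Main.v *)
Require Import Defs.
From mathcomp Require Import all_boot all_algebra.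
From mathcomp Require Import all_classical all_reals all_analysis.

(** The points of [X] sit inside the hyperspace as the singletons, equivariantly,
    and in a Hausdorff space the sets with at most one point form a closed subset
    of the hyperspace ([closed_is_subset1]).  Evaluation at a singleton is
    continuous on pointwise maps and sends every translation [hact F t] to a
    singleton, so every element [p] of the enveloping semigroup of the hyperspace
    sends singletons to singletons ([enveloping_on_points]).  Writing
    [p {x} = {q x}] therefore defines a map [q : X -> X], the trace of [p] on
    points, and the homomorphism is [p |-> q].

    Restricted to singletons the Vietoris topology is the topology of [X], so
    taking the trace is continuous at every map that preserves singletons
    ([on_points_continuous]); since it sends [hact F t] to [F t], it carries the
    closure of the translations of the hyperspace into the closure of the
    translations of [X].  It is onto because its image is compact, hence closed
    in the Hausdorff space of all maps [X -> X], and contains every [F t]. *)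

Section points_of_hyperspace.
Local Open Scope classical_set_scope.
Context {X : topologicalType}.
Hypothesis T2 : hausdorff_space X.

(** Two points of a limit [A] of sets with at most one point cannot be
    separated: if [U] and [V] are neighborhoods of them, meeting both [U] and [V]
    is a Vietoris neighborhood of [A], and a one-point set meeting both puts its
    point in [U `&` V]. *)
Lemma closed_is_subset1 : closed [set A : hyperspace X | is_subset1 A].
Proof.
move=> A clA a b Aa Ab; apply: T2 => U V nU nV.
have meetA W c : hset A c -> nbhs c W -> nbhs A (vietoris_meet W°).
  move=> Ac nW; apply: open_nbhs_nbhs; split.
    apply: vietoris_subbase_open; right; exists W° => //; exact: open_interior.
  by exists c; split => //; exact: nbhs_singleton (nbhs_interior nW).
have [B [B1 [[u [Bu Uu]] [v [Bv Vv]]]]] :=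
  clA _ (filterI (meetA _ _ Aa nU) (meetA _ _ Ab nV)).
exists u; split; first exact: interior_subset Uu.
by rewrite (B1 _ _ Bu Bv); exact: interior_subset Vv.
Qed.

Definition hyperspace1 (x : X) : hyperspace X :=
  Hyperspace (@accessible_closed_set1 X (hausdorff_accessible T2) x)
    (ex_intro _ x erefl).

(** The default value [x] is taken only if [p] sends [{x}] to the empty set,
    which the type of [p] excludes. *)
Definition on_points (p : {ptws hyperspace X -> hyperspace X}) :
  {ptws X -> X} := fun x => xget x (hset (p (hyperspace1 x))).

Lemma on_pointsP p x : hset (p (hyperspace1 x)) (on_points p x).
Proof. exact: xgetPex (hset_neq0 _). Qed.

(** At coordinate [x], a neighborhood [U] of the only point of [p {x}] gives the
    neighborhood of those [r] with [r {x} `<=` U], whatever point of [r {x}] is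
    then selected. *)
Lemma on_points_continuous (p : {ptws hyperspace X -> hyperspace X}) :
  (forall x, is_subset1 (p (hyperspace1 x))) ->
  {for p, continuous on_points}.
Proof.
move=> p1; apply: (@ptws_cvg _ _ _ (fmap_filter _ (nbhs_filter p))) => x U.
rewrite nbhsE => -[V [oV Vpx] VU].
have : nbhs p [set r : {ptws hyperspace X -> hyperspace X} |
    vietoris_subset V (r (hyperspace1 x))].
  apply: (@ptws_eval_continuous _ _ (hyperspace1 x) p); apply: open_nbhs_nbhs.
  split; first by apply: vietoris_subbase_open; left; exists V.
  by move=> y py; rewrite (p1 x _ _ py (on_pointsP p x)).
by apply: filterS => r rV; apply/VU/rV/on_pointsP.
Qed.

Context {T : groupType} (F : flow T X).

Lemma on_points_hact t : on_points (hact F t) = F t.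
Proof. by apply/funext => x; have [_ /= -> <-] := on_pointsP (hact F t) x. Qed.

Lemma enveloping_on_points (p : {ptws hyperspace X -> hyperspace X}) x :
  enveloping (induced_flow F) p -> is_subset1 (p (hyperspace1 x)).
Proof.
move=> Ep; apply: closed_is_subset1 => W.
move=> /(@ptws_eval_continuous _ _ (hyperspace1 x) p) /Ep.
move=> [_ [[t _ <-] Wt]]; exists (hact F t (hyperspace1 x)); split => //.
by move=> _ _ [_ -> <-] [_ -> <-].
Qed.

Lemma on_points_enveloping p :
  enveloping (induced_flow F) p -> enveloping F (on_points p).
Proof.
move=> Ep U nU.
have /Ep[_ [[t _ <-] Ut]] : nbhs p [set r | U (on_points r)].
  by apply: on_points_continuous nU => x; exact: enveloping_on_points.
by exists (F t); split; [exists t | rewrite -on_points_hact].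
Qed.

Lemma on_points_enveloping_continuous :
  continuous (fun p : enveloping (induced_flow F) => on_points (set_val p)).
Proof.
move=> p; apply: (cvg_comp (fun p : enveloping (induced_flow F) => set_val p)
  on_points (G := nbhs (set_val p))).
  exact: initial_continuous.
by apply: on_points_continuous => x; exact: enveloping_on_points (set_valP p).
Qed.

Definition enveloping_trace (p : enveloping (induced_flow F)) : enveloping F :=
  exist _ (on_points (set_val p)) (mem_set (on_points_enveloping _ (set_valP p))).

Lemma enveloping_trace_surj q : exists p, enveloping_trace p = q.
Proof.
pose f (p : enveloping (induced_flow F)) := on_points (set_val p).
have fK : compact (range f).
  apply: continuous_compact; last exact: enveloping_compact.
  exact/continuous_subspaceT/on_points_enveloping_continuous.
have : closure (range f) `<=` range f.
  have T2XX : hausdorff_space {ptws X -> X} by exact: hausdorff_product.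
  by have /closure_id <- := compact_closed T2XX fK.
have subf : [set (F t : {ptws X -> X}) | t in [set: T]] `<=` range f.
  move=> _ [t _ <-].
  have Et : enveloping (induced_flow F) (hact F t).
    by apply: subset_closure; exists t.
  by exists (SigSub (mem_set Et)) => //; exact: on_points_hact.
move=> /(_ _ (closureS subf (set_valP q)))[p _ fpq].
by exists p; apply: val_inj.
Qed.

Lemma enveloping_trace_hom :
  flow_hom (enveloping_flow (induced_flow F)) (enveloping_flow F) enveloping_trace.
Proof.
split; last 1 first.
- move=> t p; apply: val_inj; apply/funext => x /=.
  have [y py <-] := on_pointsP (hact F t \o set_val p) x.
  by rewrite (enveloping_on_points _ x (set_valP p) _ _ py (on_pointsP _ x)).
- exact/continuous_comp_initial/on_points_enveloping_continuous.
- exact: enveloping_trace_surj.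
Qed.

End points_of_hyperspace.

Theorem theorem10p2 (R : realType) (T : groupType) (X : metricType R)
    (F : flow T X) :
  exists Theta : enveloping (induced_flow F) -> enveloping F,
    flow_hom (enveloping_flow (induced_flow F)) (enveloping_flow F) Theta.
Proof.
exists (enveloping_trace (@metric_hausdorff R X) F).
exact: enveloping_trace_hom.
Qed.
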